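(* CTL+Sync extended with sequences of unary temporal operators is strictly more expressive than CTL+Sync, in the following strong sense: every CTL+Sync formula is a formula of the extended logic, and there is a formula of the extended logic not using the Next operators, namely $GF\forall p$ for an atomic proposition $p$, such that for every CTL+Sync formula $\varphi$ (possibly using the Next operators $\exists\mathcal X,\forall\mathcal X$) there exist a Kripke structure $K$ and a state $t$ with $K,t\models\varphi$ and $K,t\not\models GF\forall p$, or $K,t\not\models\varphi$ and $K,t\models GF\forall p$.
   Context: A Kripke structure is $K=\langle T,\Pi,\pi,R\rangle$ with $T$ a finite set of states, $\Pi$ a finite set of atomic propositions, $\pi:T\to 2^{\Pi}$ a labeling, $R\subseteq T\times T$ a transition relation; $R(t)=\{t'\mid(t,t')\in R\}$. A path is an infinite sequence $t_0t_1\dots$ with $(t_i,t_{i+1})\in R$. CTL+Sync formulas: $\varphi ::= p \mid \neg\varphi_1 \mid \varphi_1\lor\varphi_2 \mid \exists\mathcal X\varphi_1 \mid \forall\mathcal X\varphi_1 \mid \varphi_1\,\exists\mathcal U\,\varphi_2 \mid \varphi_1\,\forall\mathcal U\,\varphi_2 \mid \varphi_1\,\mathcal U\exists\,\varphi_2 \mid \varphi_1\,\mathcal U\forall\,\varphi_2$, $p\in\Pi$, with semantics: standard for $p,\neg,\lor$; $\exists\mathcal X\varphi_1$ / $\forall\mathcal X\varphi_1$: some / every successor satisfies $\varphi_1$; $\varphi_1\exists\mathcal U\varphi_2$: some path from $t$ has a $k$ with $\varphi_2$ at position $k$ and $\varphi_1$ at all positions $j<k$; $\varphi_1\forall\mathcal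 U\varphi_2$: every path from $t$ has such a $k$; $\varphi_1\,\mathcal U\exists\,\varphi_2$: there exists $k\ge0$ such that for all $0\le j<k$ some path $t_0t_1\dots$ from $t$ has $K,t_j\models\varphi_1$ and $K,t_k\models\varphi_2$; $\varphi_1\,\mathcal U\forall\,\varphi_2$: there exists $k\ge0$ such that for all $0\le j<k$ and all paths $t_0t_1\dots$ from $t$, $K,t_j\models\varphi_1$ and $K,t_k\models\varphi_2$. The extension adds formulas $\mathcal T Q\varphi_1$ with $\mathcal T=O_1\cdots O_m\in\{F,G\}^+$ and $Q\in\{\exists,\forall\}$, where $K,t\models O_1\cdots O_m Q\varphi_1$ iff $\mathsf Q_1 k_1\ge 0\ \mathsf Q_2 k_2\ge k_1\cdots \mathsf Q_m k_m\ge k_{m-1}$ such that for $Q$ (some/all) paths $t_0t_1\dots$ with $t_0=t$, $K,t_{k_m}\models\varphi_1$, where $\mathsf Q_i$ is ''there exists'' if $O_i=F$ and ''for all'' if $O_i=G$. In particular $K,t\models GF\forall p$ iff for every $k\ge0$ there is $j\ge k$ such that $p\in\pi(t_j)$ for every path $t_0t_1\dots$ with $t_0=t$. *)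

(* Defs.v *)
From mathcomp Require Import all_boot.

Set Implicit Arguments.
Unset Strict Implicit.
Unset Printing Implicit Defensive.

(* The transition relation is not assumed to be total. *)
Record kripke (AP : finType) := Kripke {
  state : finType;
  label : state -> {set AP};
  trans : rel state
}.

Definition path_from (AP : finType) (K : kripke AP) (t : state K)
    (r : nat -> state K) : Prop :=
  r 0 = t /\ forall i, trans (r i) (r i.+1).

Inductive path_quantifier := SomePath | AllPaths.

Inductive unary_op := OpF | OpG.

Inductive ctlsync (AP : finType) :=
  | CAtom of AP
  | CNot of ctlsync AP
  | COr of ctlsync AP & ctlsync AP
  | CEX of ctlsync AP
  | CAX of ctlsync AP
  | CEU of ctlsync AP & ctlsync AP
  | CAU of ctlsync AP & ctlsync AP
  | CUE of ctlsync AP & ctlsync AP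
  | CUA of ctlsync AP & ctlsync AP.

(* XSeq o s Q f stands for the formula (o :: s) Q f: the sequence of unary
   operators is non-empty. *)
Inductive ctlsync_ext (AP : finType) :=
  | XAtom of AP
  | XNot of ctlsync_ext AP
  | XOr of ctlsync_ext AP & ctlsync_ext AP
  | XEX of ctlsync_ext AP
  | XAX of ctlsync_ext AP
  | XEU of ctlsync_ext AP & ctlsync_ext AP
  | XAU of ctlsync_ext AP & ctlsync_ext AP
  | XUE of ctlsync_ext AP & ctlsync_ext AP
  | XUA of ctlsync_ext AP & ctlsync_ext AP
  | XSeq of unary_op & seq unary_op & path_quantifier & ctlsync_ext AP.

Arguments CAtom {AP} _.
Arguments XAtom {AP} _.

Fixpoint embed (AP : finType) (f : ctlsync AP) : ctlsync_ext AP :=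
  match f with
  | CAtom p => XAtom p
  | CNot f1 => XNot (embed f1)
  | COr f1 f2 => XOr (embed f1) (embed f2)
  | CEX f1 => XEX (embed f1)
  | CAX f1 => XAX (embed f1)
  | CEU f1 f2 => XEU (embed f1) (embed f2)
  | CAU f1 f2 => XAU (embed f1) (embed f2)
  | CUE f1 f2 => XUE (embed f1) (embed f2)
  | CUA f1 f2 => XUA (embed f1) (embed f2)
  end.

Fixpoint next_free (AP : finType) (f : ctlsync_ext AP) : bool :=
  match f with
  | XAtom _ => true
  | XNot f1 => next_free f1
  | XOr f1 f2 => next_free f1 && next_free f2
  | XEX _ => false
  | XAX _ => false
  | XEU f1 f2 => next_free f1 && next_free f2
  | XAU f1 f2 => next_free f1 && next_free f2
  | XUE f1 f2 => next_free f1 && next_free f2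
  | XUA f1 f2 => next_free f1 && next_free f2
  | XSeq _ _ _ f1 => next_free f1
  end.

Section Semantics.
Variables (AP : finType) (K : kripke AP).
Implicit Types (P A B : state K -> Prop) (t : state K).

Definition sem_EX P t : Prop := exists2 t', trans t t' & P t'.

Definition sem_AX P t : Prop := forall t', trans t t' -> P t'.

Definition until A B (r : nat -> state K) : Prop :=
  exists k, B (r k) /\ forall j, j < k -> A (r j).

Definition sem_EU A B t : Prop := exists2 r, path_from t r & until A B r.

Definition sem_AU A B t : Prop := forall r, path_from t r -> until A B r.

(* In the synchronized untils, the requirement on B at position k does not
   depend on j and has to hold for k = 0 too, when there is no j < k; it is
   therefore stated outside the quantification over j. *)
Definition sem_UE A B t : Prop :=
  exists k,
    (exists2 r, path_from t r & B (r k)) /\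
    forall j, j < k -> exists2 r, path_from t r & A (r j) /\ B (r k).

Definition sem_UA A B t : Prop :=
  exists k,
    (forall r, path_from t r -> B (r k)) /\
    forall j, j < k -> forall r, path_from t r -> A (r j) /\ B (r k).

Definition quantify_paths (Q : path_quantifier) t
    (C : (nat -> state K) -> Prop) : Prop :=
  match Q with
  | SomePath => exists2 r, path_from t r & C r
  | AllPaths => forall r, path_from t r -> C r
  end.

(* D k_m, prefixed by the quantifications over k_1 >= k0, k_2 >= k_1, ...,
   k_m >= k_(m-1) given by the operators of s. *)
Fixpoint quantify_positions (s : seq unary_op) (k0 : nat) (D : nat -> Prop) :
    Prop :=
  match s with
  | [::] => D k0
  | OpF :: s' => exists k, k0 <= k /\ quantify_positions s' k D
  | OpG :: s' => forall k, k0 <= k -> quantify_positions s' k D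
  end.

Definition sem_seq (s : seq unary_op) (Q : path_quantifier) P t : Prop :=
  quantify_positions s 0 (fun k => quantify_paths Q t (fun r => P (r k))).

Fixpoint sat (f : ctlsync AP) : state K -> Prop :=
  match f with
  | CAtom p => fun t => p \in label t
  | CNot f1 => fun t => ~ sat f1 t
  | COr f1 f2 => fun t => sat f1 t \/ sat f2 t
  | CEX f1 => sem_EX (sat f1)
  | CAX f1 => sem_AX (sat f1)
  | CEU f1 f2 => sem_EU (sat f1) (sat f2)
  | CAU f1 f2 => sem_AU (sat f1) (sat f2)
  | CUE f1 f2 => sem_UE (sat f1) (sat f2)
  | CUA f1 f2 => sem_UA (sat f1) (sat f2)
  end.

Fixpoint sat_ext (f : ctlsync_ext AP) : state K -> Prop :=
  match f with
  | XAtom p => fun t => p \in label t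
  | XNot f1 => fun t => ~ sat_ext f1 t
  | XOr f1 f2 => fun t => sat_ext f1 t \/ sat_ext f2 t
  | XEX f1 => sem_EX (sat_ext f1)
  | XAX f1 => sem_AX (sat_ext f1)
  | XEU f1 f2 => sem_EU (sat_ext f1) (sat_ext f2)
  | XAU f1 f2 => sem_AU (sat_ext f1) (sat_ext f2)
  | XUE f1 f2 => sem_UE (sat_ext f1) (sat_ext f2)
  | XUA f1 f2 => sem_UA (sat_ext f1) (sat_ext f2)
  | XSeq o s Q f1 => sem_seq (o :: s) Q (sat_ext f1)
  end.

End Semantics.

Definition GFforall (AP : finType) (p : AP) : ctlsync_ext AP :=
  XSeq OpG [:: OpF] AllPaths (XAtom p).

Lemma sat_GFforall (AP : finType) (K : kripke AP) (t : state K) (p : AP) :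
  sat_ext (GFforall p) t <->
  forall k, exists j, k <= j /\ forall r, path_from t r -> p \in label (r j).
Proof. by split=> h k; [exact: h | move=> _; exact: h]. Qed.

(* Main.v *)
(** Fix a bound [n] on the nesting depth of the Next operators. In a
    deterministic structure where consecutive [p]-states are more than [n] steps
    apart, a formula only sees the distance to the next [p], truncated at [n].
    Consider a root that branches into two deterministic runs, one with a [p]
    every [M] steps, one with a [p] every [M + 1] steps for a long while and
    every [M] steps afterwards. By the Chinese remainder theorem every pair of
    truncated distances occurs in the first [M (M + 1)] steps, so a synchronized
    until at the root is settled there: a later witness can be replaced by an
    earlier one with the same pair. Whether the [p]s of the two runs eventually
    coincide depends only on the length of the second run's slow phase, which
    formulas of depth [n] cannot observe. *)
Require Import Defs.
From mathcomp Require Import all_boot zify.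
From Stdlib Require Import Classical.

Set Implicit Arguments.
Unset Strict Implicit.
Unset Printing Implicit Defensive.

(** Stated as an equality of predicates, so that the induction hypotheses rewrite under the semantic
    operators. *)
Lemma sat_ext_embed (AP : finType) (K : kripke AP) (f : ctlsync AP) :
  @sat_ext AP K (embed f) = @sat AP K f.
Proof.
by elim: f => //= [f ->|f -> g ->|f ->|f ->|f -> g ->|f -> g ->|f -> g ->|f -> g ->].
Qed.

(** Untils cost nothing: on deterministic runs they are insensitive to stuttering. *)
Fixpoint next_depth (AP : finType) (f : ctlsync AP) : nat :=
  match f with
  | CAtom _ => 0
  | CNot f1 => next_depth f1
  | CEX f1 | CAX f1 => (next_depth f1).+1
  | COr f1 f2 | CEU f1 f2 | CAU f1 f2 | CUE f1 f2 | CUA f1 f2 =>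
      maxn (next_depth f1) (next_depth f2)
  end.

(** * Structures with at most two runs from each state *)

Section TwoRuns.
Variables (AP : finType) (K : kripke AP).
Implicit Types (A B : state K -> Prop) (R : bool -> nat -> state K).

Definition two_runs (t : state K) R : Prop :=
  (forall b, path_from t (R b)) /\
  forall r, path_from t r -> exists b, r =1 R b.

Lemma eq_until A B (r r' : nat -> state K) :
  r =1 r' -> until A B r -> until A B r'.
Proof.
move=> e [k [hB hA]]; exists k; split=> [|j /hA]; first by rewrite -e.
by rewrite e.
Qed.

Lemma until_cons A B (r : nat -> state K) :
  until A B r <-> B (r 0) \/ A (r 0) /\ until A B (fun k => r k.+1).
Proof.
split=> [[[|k] [hB hA]]|[hB|[hA [k [hB hAk]]]]].
- by left.
- by right; split; [exact: hA | exists k; split=> // j; apply: (hA j.+1)].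
- by exists 0.
- by exists k.+1; split=> // -[|j] // /hAk.
Qed.

Lemma sem_EU_two_runs A B t R :
  two_runs t R -> sem_EU A B t <-> exists b, until A B (R b).
Proof.
case=> hR allR; split=> [[r /allR[b e] u]|[b u]]; last by exists (R b).
by exists b; apply: eq_until u.
Qed.

Lemma sem_AU_two_runs A B t R :
  two_runs t R -> sem_AU A B t <-> forall b, until A B (R b).
Proof.
case=> hR allR; split=> [u b|u r /allR[b e]]; first exact: u.
by apply: eq_until (u b) => i; rewrite e.
Qed.

Lemma sem_UE_two_runs A B t R :
  two_runs t R ->
  sem_UE A B t <->
  exists k, (exists b, B (R b k)) /\
    forall j, j < k -> exists b, A (R b j) /\ B (R b k).
Proof.
case=> hR allR; split=> -[k [hB hA]]; exists k; split.
- by case: hB => r /allR[b e] hB; exists b; rewrite -e.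
- by move=> j /hA[r /allR[b e] hAB]; exists b; rewrite -!e.
- by case: hB => b hB; exists (R b).
- by move=> j /hA[b hAB]; exists (R b).
Qed.

Lemma sem_UA_two_runs A B t R :
  two_runs t R ->
  sem_UA A B t <->
  exists k, (forall b, B (R b k)) /\
    forall j, j < k -> forall b, A (R b j) /\ B (R b k).
Proof.
case=> hR allR; split=> -[k [hB hA]]; exists k; split.
- by move=> b; apply: hB.
- by move=> j jk b; apply: hA.
- by move=> r /allR[b e]; rewrite e.
- by move=> j jk r /allR[b e]; rewrite !e; apply: hA.
Qed.

(** One [k'] serves both branches, as a synchronized until fixes one position for all paths. The
    transfer is branchwise, hence fits both path quantifiers. *)
Definition early_match A B R R' : Prop :=
  forall k, exists k', forall b, (B (R b k) -> B (R' b k')) /\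
    forall j, j < k' -> j < k /\ (A (R b j) -> A (R' b j)).

Lemma sem_UE_early_match A B t t' R R' :
  two_runs t R -> two_runs t' R' -> early_match A B R R' ->
  sem_UE A B t -> sem_UE A B t'.
Proof.
move=> /sem_UE_two_runs-> /sem_UE_two_runs-> m [k [[b hB] hA]].
have [k' hk'] := m k; exists k'; split; first by exists b; apply: (hk' b).1.
move=> j jk'; have [jk _] := (hk' true).2 j jk'.
have [c [hAc hBc]] := hA j jk; exists c; split; last exact: (hk' c).1.
by apply: ((hk' c).2 j jk').2.
Qed.

Lemma sem_UA_early_match A B t t' R R' :
  two_runs t R -> two_runs t' R' -> early_match A B R R' ->
  sem_UA A B t -> sem_UA A B t'.
Proof.
move=> /sem_UA_two_runs-> /sem_UA_two_runs-> m [k [hB hA]].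
have [k' hk'] := m k; have hB' b : B (R' b k') by apply: (hk' b).1.
exists k'; split=> // j jk' b; split=> //.
by have [jk] := (hk' b).2 j jk'; apply; have [] := hA j jk b.
Qed.

End TwoRuns.

(** * Forks of deterministic runs *)

Section Fork.
Variables (AP : finType) (p : AP) (S : finType) (nxt : S -> S) (d : S -> nat).

(* [inl s] is a state of the functional graph [nxt], in which [d s] is meant as
   the distance to the next [p]; [inr (x, y)] is a root branching to [x] and
   [y]. *)
Definition fork : kripke AP :=
  @Kripke AP (S + S * S)%type
    (fun t => if t is inl s then (if d s == 0 then [set p] else set0) else set0)
    (fun t t' => match t, t' with
                 | inl s, inl s' => s' == nxt s
                 | inr (x, y), inl s' => (s' == x) || (s' == y)
                 | _, inr _ => false
                 end).

Definition run (s : S) (k : nat) : state fork := inl (iter k nxt s).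

Definition root_run (x y : S) (b : bool) (k : nat) : state fork :=
  if k is k'.+1 then run (if b then x else y) k' else inr (x, y).

Lemma path_from_inl (s : S) (r : nat -> state fork) :
  path_from (inl s : state fork) r -> r =1 run s.
Proof.
case=> r0 hr; elim=> [|k IH]; first exact: r0.
by move: (hr k); rewrite IH; case: (r k.+1) => //= s' /eqP->.
Qed.

Lemma two_runs_inl s : two_runs (inl s : state fork) (fun=> run s).
Proof.
split=> [_|r /path_from_inl e]; last by exists true.
by split=> // i; rewrite /run /=.
Qed.

Lemma two_runs_inr x y : two_runs (inr (x, y) : state fork) (root_run x y).
Proof.
split=> [b|r [r0 hr]].
  split=> // -[|i] /=; last exact: eqxx.
  by case: b; rewrite eqxx ?orbT.
have: exists b, r 1 = inl (if b then x else y).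
  move: (hr 0); rewrite r0; case: (r 1) => //= s /orP[] /eqP->.
  - by exists true.
  - by exists false.
case=> b r1; exists b => -[|k] //=.
by apply: (@path_from_inl _ (fun k => r k.+1)); split.
Qed.

Lemma sem_UE_inl A B s :
  sem_UE A B (inl s : state fork) <-> until A B (run s).
Proof.
rewrite (sem_UE_two_runs _ _ (two_runs_inl s)).
split=> -[k [hB hA]]; exists k; split.
- by case: hB.
- by move=> j /hA[_ []].
- by exists true.
- by move=> j /hA; exists true.
Qed.

Lemma sem_UA_inl A B s :
  sem_UA A B (inl s : state fork) <-> until A B (run s).
Proof.
rewrite (sem_UA_two_runs _ _ (two_runs_inl s)).
split=> -[k [hB hA]]; exists k; split=> //.
- exact: (hB true).
- by move=> j /hA/(_ true)[].
- by move=> j /hA.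
Qed.

Lemma sem_EU_inl A B s :
  sem_EU A B (inl s : state fork) <-> until A B (run s).
Proof.
rewrite (sem_EU_two_runs _ _ (two_runs_inl s)).
by split=> [[]//|]; exists true.
Qed.

Lemma sem_AU_inl A B s :
  sem_AU A B (inl s : state fork) <-> until A B (run s).
Proof.
rewrite (sem_AU_two_runs _ _ (two_runs_inl s)).
by split=> // /(_ true).
Qed.

Lemma sem_EX_inl A s : sem_EX A (inl s : state fork) <-> A (inl (nxt s)).
Proof.
by split=> [[[s'|//] /eqP->]//|hA]; exists (inl (nxt s)) => //=.
Qed.

Lemma sem_AX_inl A s : sem_AX A (inl s : state fork) <-> A (inl (nxt s)).
Proof.
by split=> [hA|hA [s'|//] /eqP->//]; apply: hA => /=.
Qed.

Lemma sem_EX_inr A x y :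
  sem_EX A (inr (x, y) : state fork) <-> A (inl x) \/ A (inl y).
Proof.
split=> [[[s'|//] /orP[] /eqP->]|[hA|hA]]; [by left|by right| |].
- by exists (inl x) => //=; rewrite eqxx.
- by exists (inl y) => //=; rewrite eqxx orbT.
Qed.

Lemma sem_AX_inr A x y :
  sem_AX A (inr (x, y) : state fork) <-> A (inl x) /\ A (inl y).
Proof.
split=> [hA|[hx hy] [s'|//] /orP[] /eqP->//].
by split; apply: hA; rewrite /= eqxx ?orbT.
Qed.

(** * Invariance under equality of truncated distances *)

Definition near_eq (n : nat) (s s' : S) : Prop := minn (d s) n = minn (d s') n.

Definition invariant_upto (n : nat) (A : state fork -> Prop) : Prop :=
  forall s s', near_eq n s s' -> A (inl s) <-> A (inl s').

Section Countdown.
Variable N : nat.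
Hypothesis d_nxt : forall s, 0 < d s -> d (nxt s) = (d s).-1.
Hypothesis d_reset : forall s, d s = 0 -> N <= d (nxt s).

Lemma d_iter s m : m <= d s -> d (iter m nxt s) = d s - m.
Proof. by elim: m => [|m IH] hm; rewrite ?subn0 //= d_nxt IH; lia. Qed.

(* One step of [s] is matched by several steps of [s'] when the truncation hides
   that [s'] is further away from its next [p] than [s]. *)
Lemma near_eq_step n s s' : n <= N -> near_eq n s s' ->
  exists m, (forall j, j < m -> near_eq n s (iter j nxt s')) /\
            near_eq n (nxt s) (iter m nxt s').
Proof.
rewrite /near_eq => nN e.
have [d0|d_gt0] := posnP (d s).
  have [n0|n_gt0] := posnP n; first by exists 0; split=> //=; lia.
  have d0' : d s' = 0 by lia.
  exists 1; split=> [[|j]//|/=].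
  by have := d_reset d0; have := d_reset d0'; lia.
have [lt_nd|le_dn] := ltnP n (d s).
  (* The truncation hides the decrement, so [s'] stays put. *)
  by exists 0; split=> //=; rewrite d_nxt //; lia.
(* [s'] advances until its distance is [(d s).-1]; this takes more than one step only if
   [d s = n < d s']. *)
exists (d s' - (d s).-1); split=> [j hj|].
  by rewrite d_iter; lia.
by rewrite d_nxt // d_iter; lia.
Qed.

(** A step may uncover a distance hidden at the cap [n.+1], hence the loss of one unit. *)
Lemma near_eq_nxt n s s' : n < N ->
  near_eq n.+1 s s' -> near_eq n (nxt s) (nxt s').
Proof.
rewrite /near_eq => nN e; have [d0|d_gt0] := posnP (d s).
  have d0' : d s' = 0 by lia.
  by have := d_reset d0; have := d_reset d0'; lia.
by rewrite !d_nxt; lia.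
Qed.

(** Stuttering argument: each step of the first run is answered by a block of steps of the second,
    all of whose states before the last are equivalent to the state being left. *)
Lemma until_run_near_eq n A B s s' : n <= N ->
  invariant_upto n A -> invariant_upto n B -> near_eq n s s' ->
  until A B (run s) -> until A B (run s').
Proof.
move=> nN iA iB + [k]; elim: k s s' => [|k IH] s s' e [hB hA].
  by exists 0; split=> //; apply/(iB _ _ e).
have [m [hm e']] := near_eq_step nN e.
have [|k' [hB' hA']] := IH _ _ e'.
  split; first by rewrite /run -iterSr.
  by move=> j jk; rewrite /run -iterSr; apply: hA.
exists (k' + m); split; first by rewrite /run iterD.
move=> j jk; have [jm|mj] := ltnP j m.
  by apply/(iA _ _ (hm j jm)); apply: (hA 0).
have -> : j = j - m + m by lia.
by rewrite /run iterD; apply: hA'; lia.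
Qed.

Lemma until_run_near_eqP n A B s s' : n <= N ->
  invariant_upto n A -> invariant_upto n B -> near_eq n s s' ->
  until A B (run s) <-> until A B (run s').
Proof. by move=> nN iA iB e; split; apply: until_run_near_eq nN iA iB _. Qed.

(** On deterministic states all four untils are the linear until, so only Next lowers [n]. The
    strict bound keeps [n] positive at atoms, where distance 0 must be visible. *)
Lemma sat_invariant_upto f n : next_depth f < n -> n <= N ->
  invariant_upto n (@sat AP fork f).
Proof.
elim: f n => [q|f IH|f IHf g IHg|f IH|f IH
  |f IHf g IHg|f IHf g IHg|f IHf g IHg|f IHf g IHg] n /= hn nN;
  try (rewrite gtn_max in hn; case/andP: hn => hf hg;
       have {}IHf := IHf n hf nN; have {}IHg := IHg n hg nN); move=> s s' e.
- by have -> : (d s == 0) = (d s' == 0) by move: e; rewrite /near_eq; lia.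
- by rewrite (IH n hn nN s s' e).
- by rewrite (IHf s s' e) (IHg s s' e).
- rewrite !sem_EX_inl; case: n hn nN e => // n hn nN /(near_eq_nxt nN).
  by apply: IH => //; lia.
- rewrite !sem_AX_inl; case: n hn nN e => // n hn nN /(near_eq_nxt nN).
  by apply: IH => //; lia.
- by rewrite !sem_EU_inl; apply: until_run_near_eqP e.
- by rewrite !sem_AU_inl; apply: until_run_near_eqP e.
- by rewrite !sem_UE_inl; apply: until_run_near_eqP e.
- by rewrite !sem_UA_inl; apply: until_run_near_eqP e.
Qed.

(** * Comparison of two roots *)

Definition root_sim (n : nat) (x y x' y' : S) : Prop :=
  forall k, exists2 k', k' <= k & forall b,
    let z := if b then x else y in let z' := if b then x' else y' in
    near_eq n (iter k nxt z) (iter k' nxt z') /\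
    forall j, j < k' -> near_eq n (iter j nxt z) (iter j nxt z').

Lemma root_sim_near_eq n x y x' y' : root_sim n x y x' y' ->
  forall b : bool, near_eq n (if b then x else y) (if b then x' else y').
Proof. by move=> /(_ 0)[k']; rewrite leqn0 => /eqP-> h b; case: (h b). Qed.

(** Position 0 is the root, about which [invariant_upto] says nothing, whence the last two
    hypotheses; later positions are shifted by one against [root_sim]. *)
Lemma root_sim_early_match n A B x y x' y' :
  invariant_upto n A -> invariant_upto n B -> root_sim n x y x' y' ->
  (A (inr (x, y)) -> A (inr (x', y'))) -> (B (inr (x, y)) -> B (inr (x', y'))) ->
  early_match A B (root_run x y) (root_run x' y').
Proof.
move=> iA iB sim hA hB [|k]; first by exists 0.
have [k' k'k h] := sim k; exists k'.+1 => b; have [e ej] := h b.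
split=> [|[|j] jk']; first by case: (iB _ _ e).
  by split.
split; first lia.
by case: (iA _ _ (ej j jk')).
Qed.

(** Here [n] stays fixed in the induction: Next leads from the root into deterministic states, and
    no transition returns to a root. Path untils are unfolded once; synchronized ones use the
    simulations. *)
Lemma sat_root_sim f n x y x' y' : next_depth f < n -> n <= N ->
  root_sim n x y x' y' -> root_sim n x' y' x y ->
  @sat AP fork f (inr (x, y)) <-> @sat AP fork f (inr (x', y')).
Proof.
move=> + nN sim sim'; have e := root_sim_near_eq sim.
have inv g : next_depth g < n -> invariant_upto n (@sat AP fork g).
  by move=> hg; apply: sat_invariant_upto.
have untilP g h b : next_depth g < n -> next_depth h < n ->
    (@sat AP fork g (inr (x, y)) <-> @sat AP fork g (inr (x', y'))) ->
    (@sat AP fork h (inr (x, y)) <-> @sat AP fork h (inr (x', y'))) ->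
    until (@sat AP fork g) (@sat AP fork h) (root_run x y b) <->
    until (@sat AP fork g) (@sat AP fork h) (root_run x' y' b).
  move=> hg hh IHg IHh; rewrite (until_cons _ _ (root_run x y b)).
  rewrite (until_cons _ _ (root_run x' y' b)) /= IHg IHh.
  by rewrite (until_run_near_eqP nN (inv g hg) (inv h hh) (e b)).
elim: f => [q|f IH|f IHf g IHg|f IH|f IH
  |f IHf g IHg|f IHf g IHg|f IHf g IHg|f IHf g IHg] /= hn;
  try (rewrite gtn_max in hn; case/andP: hn => hf hg;
       have {}IHf := IHf hf; have {}IHg := IHg hg).
- by [].
- by rewrite IH.
- by rewrite IHf IHg.
- have hf : next_depth f < n by lia.
  by rewrite !sem_EX_inr (inv f hf _ _ (e true)) (inv f hf _ _ (e false)).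
- have hf : next_depth f < n by lia.
  by rewrite !sem_AX_inr (inv f hf _ _ (e true)) (inv f hf _ _ (e false)).
- rewrite !(sem_EU_two_runs _ _ (two_runs_inr _ _)).
  by split=> -[b] /(untilP f g b hf hg IHf IHg); exists b.
- rewrite !(sem_AU_two_runs _ _ (two_runs_inr _ _)).
  by split=> u b; apply/(untilP f g b hf hg IHf IHg).
- split; apply: sem_UE_early_match (two_runs_inr _ _) (two_runs_inr _ _) _;
    apply: root_sim_early_match (inv f hf) (inv g hg) _ _ _ => //.
  + by case: IHf. + by case: IHg. + by case: IHf. + by case: IHg.
- split; apply: sem_UA_early_match (two_runs_inr _ _) (two_runs_inr _ _) _;
    apply: root_sim_early_match (inv f hf) (inv g hg) _ _ _ => //.
  + by case: IHf. + by case: IHg. + by case: IHf. + by case: IHg.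
Qed.

End Countdown.

Lemma sat_GFforall_inr x y :
  @sat_ext AP fork (GFforall p) (inr (x, y)) <->
  forall k, exists2 j, k <= j & d (iter j nxt x) = 0 /\ d (iter j nxt y) = 0.
Proof.
rewrite sat_GFforall; have [hR allR] := two_runs_inr x y.
have lab s : p \in @label AP fork (inl s) <-> d s = 0.
  by rewrite /=; case: eqP => [->|ne]; rewrite ?set11 ?inE.
split=> [h k|h k].
  (* Asking for [k.+1] rules out the root position and absorbs its offset. *)
  have [[|j] [kj hj]] := h k.+1; first by [].
  exists j => //; split; apply/lab.
  - exact: hj _ (hR true).
  - exact: hj _ (hR false).
have [j kj [jx jy]] := h k; exists j.+1; split; first exact: leqW.
move=> r /allR[b ->]; apply/lab.
by case: b.
Qed.

End Fork.

(** * Two periodic runs *)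

(* The states below [M] form a cycle; those above lead down to it, with a [p]
   at [M + (M + 1) a] for every [a]. *)
Definition countdown (M i : nat) : nat := if i is i'.+1 then i' else M.-1.

Definition dist (M i : nat) : nat := if i < M then i else (i - M) %% M.+1.

(** For positive [M], the run from here makes [a] rounds of length [M.+1] down to [M], then rounds
    of length [M]. *)
Definition tail_start (M a : nat) : nat := M + M.+1 * a.

Lemma dist_countdown M i : 0 < dist M i ->
  dist M (countdown M i) = (dist M i).-1.
Proof.
rewrite /dist; case: (ltnP i M) => [|Mi]; first by case: i => //= i iM _; rewrite ltnW.
move=> h; case: i Mi h => [|i] Mi h /=; first by move: h; rewrite sub0n mod0n.
have lt_Mi : M <= i.
  by move: Mi h; rewrite leq_eqVlt => /orP[/eqP->|//]; rewrite subnn mod0n.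
by rewrite ltnNge lt_Mi /=; move: h; rewrite subSn // modnS; case: ifP.
Qed.

Lemma dist_reset M i : dist M i = 0 -> M.-1 <= dist M (countdown M i).
Proof.
rewrite /dist; case: (ltnP i M) => [iM i0|Mi].
  by rewrite i0 /=; case: (ltnP M.-1 M) => //; lia.
move=> /eqP/dvdnP[q e]; have -> : i = q * M.+1 + M by lia.
case: q {e} => [|q].
  by rewrite mul0n add0n; case: (M) => //= m; rewrite ltnSn.
rewrite mulSn /= ifF; last by lia.
have -> : M + q * M.+1 + M - M = q * M.+1 + M by lia.
by rewrite modnMDl modn_small; lia.
Qed.

Lemma dist_le M i : dist M i <= M.
Proof. by rewrite /dist; case: (ltnP i M) => [/ltnW//|_]; rewrite -ltnS ltn_pmod. Qed.

Lemma iter_countdown_tail M m i : m <= i -> iter m (countdown M) i = i - m.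
Proof.
elim: m => [|m IH] h; first by rewrite subn0.
by rewrite iterS IH ?(ltnW h) //; case e: (i - m) => [|c] /=; lia.
Qed.

(** The state after [k] steps is the residue of [-k] modulo [M]. *)
Lemma iter_countdown_cycle M k : 0 < M ->
  iter k (countdown M) 0 < M /\ M %| iter k (countdown M) 0 + k.
Proof.
move=> M0; elim: k => [|k [IHlt IHd]]; first by [].
rewrite iterS; case: (iter k _ 0) IHlt IHd => [|c] /= hc hd; last first.
  by split; [lia | rewrite -addSnnS].
split; first by lia.
have -> : M.-1 + k.+1 = M + (0 + k) by lia.
by rewrite dvdn_addr.
Qed.

Lemma iter_cycle_eq M k a : 0 < M -> a < M -> M %| a + k ->
  iter k (countdown M) 0 = a.
Proof.
move=> M0 aM ha; have [lt hd] := iter_countdown_cycle k M0.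
have /eqP : iter k (countdown M) 0 = a %[mod M].
  by apply/eqP; rewrite -(eqn_modDr k); move: ha hd; rewrite /dvdn => /eqP-> /eqP->.
by rewrite !modn_small // => /eqP.
Qed.

(** In the slow phase the distance is the residue of [-m] modulo [M.+1], whatever [a] is. *)
Lemma dist_tail_eq M m a b : m <= M.+1 * a -> b <= M -> M.+1 %| b + m ->
  dist M (iter m (countdown M) (tail_start M a)) = b.
Proof.
rewrite /tail_start => hm bM hb.
rewrite iter_countdown_tail; last by lia.
rewrite /dist ifF; last by lia.
have -> : M + M.+1 * a - m - M = M.+1 * a - m by lia.
have /eqP : M.+1 * a - m = b %[mod M.+1].
  apply/eqP; rewrite -(eqn_modDr m) subnK //.
  by move: hb; rewrite /dvdn => /eqP->; rewrite mulnC modnMl.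
by rewrite (modn_small (_ : b < M.+1)) // => /eqP.
Qed.

(* Explicit Chinese remainders: [M + 1 = 1] modulo [M] and [M = -1] modulo
   [M + 1]. *)
Lemma chinese_consecutive M a b : 0 < M -> a <= M ->
  exists2 k, k < M * M.+1 & M %| a + k /\ M.+1 %| b + k.
Proof.
move=> M0 aM; pose k0 := M * b + M.+1 * (M - a).
have N0 : 0 < M * M.+1 by rewrite muln_gt0 M0.
exists (k0 %% (M * M.+1)); first by rewrite ltn_pmod.
have hmod c q : q %| M * M.+1 -> q %| c + k0 -> q %| c + k0 %% (M * M.+1).
  by move=> hq; rewrite {1}(divn_eq k0 (M * M.+1)) addnCA dvdn_addr // dvdn_mull.
split; apply: hmod.
- exact: dvdn_mulr.
- have -> : a + k0 = M * (b + (M - a) + 1) by rewrite /k0; nia.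
  exact: dvdn_mulr.
- exact: dvdn_mull.
- have -> : b + k0 = M.+1 * (b + (M - a)) by rewrite /k0; nia.
  exact: dvdn_mulr.
Qed.

Lemma dist_tail_irrel M m a a' : m <= M.+1 * a -> m <= M.+1 * a' ->
  dist M (iter m (countdown M) (tail_start M a)) =
  dist M (iter m (countdown M) (tail_start M a')).
Proof.
(* [M * m] represents [-m], as [M] is [-1] modulo [M.+1]. *)
move=> ha ha'; have bM : (M * m) %% M.+1 <= M by rewrite -ltnS ltn_pmod.
have hb : M.+1 %| (M * m) %% M.+1 + m.
  by rewrite /dvdn modnDml -mulSnr mulnC modnMl.
by rewrite !(dist_tail_eq _ bM hb).
Qed.

(** Both slow phases last at least [M * M.+1] steps. A smaller [k] matches itself; for a larger one,
    even past the slow phase, Chinese remainders realize the same pair of distances within these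
    steps. *)
Lemma dist_pair_sim M a a' k : 0 < M -> M <= a -> M <= a' ->
  exists2 k', k' <= k &
    [/\ dist M (iter k (countdown M) 0) = dist M (iter k' (countdown M) 0),
        dist M (iter k (countdown M) (tail_start M a)) =
        dist M (iter k' (countdown M) (tail_start M a'))
      & forall j, j < k' -> dist M (iter j (countdown M) (tail_start M a)) =
                            dist M (iter j (countdown M) (tail_start M a'))].
Proof.
move=> M0 ha ha'.
have small j c : j < M * M.+1 -> M <= c -> j <= M.+1 * c by move=> ? ?; nia.
have [kN|Nk] := ltnP k (M * M.+1).
  exists k => //; split=> // [|j jk]; apply: dist_tail_irrel; apply: small => //;
  exact: ltn_trans jk kN.
have [lt hd] := iter_countdown_cycle k M0.
have bM := dist_le M (iter k (countdown M) (tail_start M a)).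
have [k' k'N [hx hy]] :=
  chinese_consecutive (dist M (iter k (countdown M) (tail_start M a))) M0 (ltnW lt).
exists k'; first exact: ltnW (leq_trans k'N Nk).
split; first by rewrite (iter_cycle_eq M0 lt hx).
  by rewrite (dist_tail_eq _ bM hy) //; apply: small.
move=> j jk'; apply: dist_tail_irrel; apply: small => //; exact: ltn_trans jk' k'N.
Qed.

(** The tail run first reaches 0 at time [tail_start M a], here a multiple of [M], hence in phase
    with the cycle run. *)
Lemma coincide_tail M a k : 0 < M -> M %| a ->
  exists2 j, k <= j & iter j (countdown M) 0 = 0 /\
                      iter j (countdown M) (tail_start M a) = 0.
Proof.
move=> M0 Ma; have dvd_t : M %| tail_start M a by rewrite dvdn_add // dvdn_mull.
exists (k * M + tail_start M a); first by nia.
split; first by apply: iter_cycle_eq => //; rewrite add0n dvdn_add // dvdn_mull.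
rewrite iterD (iter_countdown_tail _ (leqnn _)) subnn.
by apply: iter_cycle_eq => //; rewrite add0n dvdn_mull.
Qed.

(** The additional slow round delays the arrival at 0 to a time congruent to 1 modulo [M]; from then
    on both runs have period [M > 1] and stay out of phase. *)
Lemma not_coincide_tail M a j : 1 < M -> M %| a -> tail_start M a.+1 <= j ->
  dist M (iter j (countdown M) 0) = 0 ->
  dist M (iter j (countdown M) (tail_start M a.+1)) <> 0.
Proof.
move=> M1 Ma hj; have M0 := ltnW M1.
have dvd0 i : dist M (iter i (countdown M) 0) = 0 -> M %| i.
  by have [lt hd] := iter_countdown_cycle i M0; rewrite /dist lt => e; rewrite e in hd.
move=> /dvd0 Mj; rewrite -{1}(subnK hj) iterD (iter_countdown_tail _ (leqnn _)) subnn.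
move=> /dvd0; rewrite dvdn_subr // => Mt.
have : M %| 1.
  have -> : 1 = tail_start M a.+1 - (M + (M * a.+1 + a)) by rewrite /tail_start; lia.
  by rewrite dvdn_sub // !dvdn_add // dvdn_mulr.
by rewrite dvdn1; lia.
Qed.

Theorem theorem3 (AP : finType) (p : AP) :
  (forall (f : ctlsync AP) (K : kripke AP) (t : state K),
     sat_ext (embed f) t <-> sat f t) /\
  exists g : ctlsync_ext AP,
    [/\ g = GFforall p,
        next_free g
      & forall f : ctlsync AP,
          exists (K : kripke AP) (t : state K),
            (sat f t /\ ~ sat_ext g t) \/ (~ sat f t /\ sat_ext g t)].
Proof.
split=> [f K t|]; first by rewrite sat_ext_embed.
exists (GFforall p); split=> // f.
(* [M.-1 = n] is the reset bound given by [dist_reset]. The roots will use [M.*2] and [M.*2.+1] slow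
   rounds: both at least [M], the first a multiple of [M]. [W] is the largest state needed. *)
pose n := (next_depth f).+1; pose M := n.+1; pose W := tail_start M (M.*2.+1).
pose nxt (i : 'I_W.+1) : 'I_W.+1 := inord (countdown M i).
pose d (i : 'I_W.+1) := dist M i.
(* [inord] never takes its default value: [countdown] decreases, or jumps from 0 to [M.-1], which is
   below [W]. *)
have iter_nxt k i : iter k nxt i = iter k (countdown M) i :> nat.
  elim: k => // k IH; rewrite !iterS /nxt IH inordK // -IH.
  case: (iter k nxt i : nat) (ltn_ord (iter k nxt i)) => [|c] /= hc; last by lia.
  by rewrite /W /tail_start; lia.
have d_nxt i : 0 < d i -> d (nxt i) = (d i).-1.
  by move=> h; rewrite /d (iter_nxt 1) dist_countdown.
have d_reset i : d i = 0 -> n <= d (nxt i).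
  by move=> h; rewrite /d (iter_nxt 1); exact: (@dist_reset M i h).
pose y a : 'I_W.+1 := inord (tail_start M a).
have val_y a : a <= M.*2.+1 -> y a = tail_start M a :> nat.
  by move=> ha; rewrite inordK // ltnS leq_add2l leq_mul2l ha orbT.
pose K := fork p nxt d; pose t a : state K := inr (ord0, y a).
have sim a a' : M <= a <= M.*2.+1 -> M <= a' <= M.*2.+1 ->
    root_sim nxt d n ord0 (y a) ord0 (y a').
  move=> /andP[Ma aM] /andP[Ma' aM'] k.
  have [k' k'k [hx hy hj]] := @dist_pair_sim M a a' k isT Ma Ma'.
  exists k' => // -[] /=; rewrite /near_eq /d; split=> [|j jk'].
  - by rewrite !iter_nxt hx.
  - by [].
  - by rewrite !iter_nxt !val_y // hy.
  - by rewrite !iter_nxt !val_y // hj.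
have satE : sat f (t M.*2) <-> sat f (t M.*2.+1).
  by apply: (@sat_root_sim AP p _ nxt d n d_nxt d_reset f n) => //; apply: sim; lia.
have M2 : M %| M.*2 by rewrite -muln2 dvdn_mulr.
have GF : sat_ext (GFforall p) (t M.*2).
  apply/sat_GFforall_inr => k; have [j kj [hx hy]] := @coincide_tail M _ k isT M2.
  by exists j => //; rewrite /d !iter_nxt val_y // hx hy.
have notGF : ~ sat_ext (GFforall p) (t M.*2.+1).
  (* [W] is the time at which this tail run reaches 0; no coincidence occurs from then on. *)
  move=> /sat_GFforall_inr/(_ W)[j Wj]; rewrite /d !iter_nxt val_y // => -[hx].
  exact: (@not_coincide_tail M M.*2 j).
(* [f] agrees on the two roots and [GFforall p] does not, so one of them separates the formulas. *)
exists K; have [sf|nsf] := classic (sat f (t M.*2)).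
  by exists (t M.*2.+1); left; split=> //; apply/satE.
by exists (t M.*2); right.
Qed.
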